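(* There exist absolute constants $\epsilon_0,\delta_0,c_0,K_0,K_1>0$ such that the following holds. For all $\epsilon\in(0,\epsilon_0)$, $\delta\in(0,\delta_0)$, $d\ge1/\epsilon^2$ and $n\ge K_0d^2/(\epsilon^2\delta)$, if $\Pi\in\mathbb{R}^{m\times n}$ satisfies (i) the column sparsity of $\Pi$ is at most $1/(9\epsilon)$, and (ii) $\Pi$ is an $(\epsilon,\delta)$-subspace-embedding for $U\sim\widetilde{\mathcal{D}}$, then $m>c_0\log^{-4}(1/\epsilon)\,\epsilon^{K_1\delta}d^2$.
   Context: For $0<\beta\le1$ with $1/\beta$ a positive integer, the distribution $\mathcal{D}_\beta$ on $n\times d$ matrices is: $U=VW$, where $V\in\mathbb{R}^{n\times (d/\beta)}$ has independent columns, each uniformly distributed over the $n$ standard basis vectors of $\mathbb{R}^n$, and $W\in\mathbb{R}^{(d/\beta)\times d}$ is independent of $V$ with, for each $i=1,\dots,d$, $W_{j,i}=\sigma_j\sqrt\beta$ for $j=(i-1)/\beta+1,\dots,i/\beta$ (independent Rademacher $\sigma_j$) and all other entries zero. Let $L=\log_2(1/\epsilon)-3$ (an integer). The distribution $\widetilde{\mathcal{D}}$ on $\mathbb{R}^{n\times d}$ is: with probability $1/2$ it is $\mathcal{D}_1$; with probability $1/2$ it is $\mathcal{D}_{2^{-\ell}}$ for $\ell$ chosen uniformly from $\{1,\dots,L\}$. A fixed $\Pi\in\mathbb{R}^{m\times n}$ is an $(\epsilon,\delta)$-subspace-embedding for $U\sim\widetilde{\mathcal{D}}$ if $\Pr_{U\sim\widetilde{\mathcal{D}}}[\forall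 x\in\mathbb{R}^d,\ (1-\epsilon)\|Ux\|_2\le\|\Pi Ux\|_2\le(1+\epsilon)\|Ux\|_2]\ge1-\delta$. Column sparsity is the maximum number of nonzero entries in a column. *)

(* Defs.v *)
From HB Require Import structures.
From mathcomp Require Import all_boot all_order all_algebra.
From mathcomp Require Import boolp classical_sets reals exp.

Set Implicit Arguments.
Unset Strict Implicit.
Unset Printing Implicit Defensive.

Import Order.TTheory GRing.Theory Num.Theory.
Local Open Scope ring_scope.

Section Defs.
Context {R : realType}.
Implicit Types (n m d k L : nat).

(* The norm that MathComp-Analysis puts on matrices is the sup norm, hence this
   separate Euclidean norm. *)
Definition norm2 n (x : 'cV[R]_n) : R := Num.sqrt (\sum_i x i 0 ^+ 2).

Definition col_sparsity m n (Pi : 'M[R]_(m, n)) : nat :=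
  (\max_(j < n) #|[set i : 'I_m | Pi i j != 0%R]|)%N.

Definition log2 (x : R) : R := ln x / ln 2.

Definition unif_pr (T : finType) (A : set T) : R :=
  #|[set w : T | `[< A w >]]|%:R / #|T|%:R.

(* Throughout, k stands for the positive integer 1 / beta, so d / beta = d * k. *)

(* h j is the index of the standard basis vector forming column j of V. *)
Definition Vmx n d k (h : {ffun 'I_(d * k) -> 'I_n}) : 'M[R]_(n, d * k) :=
  \matrix_(r, j) (r == h j)%:R.

(* The sign sigma_j is encoded as (-1) ^+ s j. With indices starting at 0, the
   rows of block i are the j with i * k <= j < (i + 1) * k. *)
Definition Wmx d k (s : {ffun 'I_(d * k) -> bool}) : 'M[R]_(d * k, d) :=
  \matrix_(j, i) if (i * k <= j < i.+1 * k)%N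
                 then (-1) ^+ s j * Num.sqrt (k%:R^-1) else 0.

(* D_beta, as the function sending an event E to Pr_{U ~ D_beta} [E]. The
   sample (h, s) is uniform on a product, so all the h j and s j are
   independent and uniform. *)
Definition D_beta n d k (E : set 'M[R]_(n, d)) : R :=
  unif_pr [set w : {ffun 'I_(d * k) -> 'I_n} * {ffun 'I_(d * k) -> bool} |
           E (Vmx w.1 *m Wmx w.2)]%classic.

(* The mixture D~, in the same format; D_(2 ^ - l) has k = 2 ^ l. *)
Definition D_tilde n d L (E : set 'M[R]_(n, d)) : R :=
  2^-1 * D_beta 1 E
  + 2^-1 * (L%:R^-1 * \sum_(1 <= l < L.+1) D_beta (2 ^ l) E).

Definition subspace_embedding m n d (eps delta : R) (Pi : 'M[R]_(m, n))
    (Pr : set 'M[R]_(n, d) -> R) : Prop :=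
  1 - delta <=
  Pr [set U | forall x : 'cV[R]_d,
        (1 - eps) * norm2 (U *m x) <= norm2 (Pi *m U *m x)
        /\ norm2 (Pi *m U *m x) <= (1 + eps) * norm2 (U *m x)]%classic.

End Defs.

(* Main.v *)
Require Import Defs.
From HB Require Import structures.
From mathcomp Require Import all_boot all_order all_algebra.
From mathcomp Require Import ring lra zify.
From mathcomp Require Import boolp classical_sets reals exp.

Set Implicit Arguments.
Unset Strict Implicit.
Unset Printing Implicit Defensive.

Import Order.TTheory GRing.Theory Num.Theory.
Local Open Scope ring_scope.

(** A pair of columns [a], [b] of [Pi] with [<Pi_a, Pi_b> > 2 eps k], drawn into
    different blocks of a sample of [D_(1/k)], spoils the embedding for one of
    the four choices of the two signs involved; so at every level [k = 2 ^ l]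
    where the failure probability is small, such pairs must be rare.

    By [D_1], at least half of the columns have norm [1 +- eps], and by sparsity
    each of those has an entry of square at least [8 eps]. Grouping columns by
    the row and sign of such an entry gives at most [2 m] groups, and inside a
    group the inner products average at least [8 eps] because the columns
    reinforce each other on the common row. Splitting this average dyadically,
    for some level [l] at least a fraction [c 2 ^ (-l) / L] of the pairs lying
    in a common group exceed [2 eps 2 ^ l]. The failure budget [delta] of the
    mixture allows at most [32 delta L] bad levels, so [l] can be lowered to a
    good level at the price of a factor [eps ^ (32 delta)]. There a second
    moment computation shows that, for [m] too small, a bad pair is sampled
    with constant probability. *)

(** * Uniform random functions *)

Lemma sumr_card (R : pzSemiRingType) (I : finType) (A : {pred I}) (x : R) :
  \sum_(i in A) x = #|A|%:R * x.
Proof. by rewrite sumr_const mulr_natl. Qed.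

Lemma sumr_cardT (R : pzSemiRingType) (I : finType) (x : R) :
  \sum_(i : I) x = #|I|%:R * x.
Proof. exact: sumr_card. Qed.

Section RandomFunction.
Variables (R : realType) (P C : finType).
Implicit Types (h : {ffun P -> C}) (i j : P) (x y : C).

Local Notation H := (#|{ffun P -> C}|%:R : R).
Local Notation c := (#|C|%:R : R).

Definition update h i x : {ffun P -> C} :=
  [ffun j => if j == i then x else h j].

Lemma update_same h i x : update h i x i = x.
Proof. by rewrite ffunE eqxx. Qed.

Lemma update_neq h i j x : j != i -> update h i x j = h j.
Proof. by rewrite ffunE => /negPf ->. Qed.

(** Exchanging [x] with [h i] is an involution of the pairs [(h, x)], so resampling one coordinate
    preserves the uniform law. *)
Lemma sum_update (F : {ffun P -> C} -> R) i :
  \sum_(h : {ffun P -> C}) \sum_x F (update h i x) = c * \sum_(h : {ffun P -> C}) F h.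
Proof.
rewrite pair_big /=.
have swapK : involutive (fun p : {ffun P -> C} * C => (update p.1 i p.2, p.1 i)).
  move=> [h x] /=; congr pair; last exact: update_same.
  by apply/ffunP => j; rewrite !ffunE; case: eqP => // ->.
rewrite (reindex_inj (inv_inj swapK)) /=.
under eq_bigr => p _.
  rewrite (_ : update _ _ _ = p.1); last first.
    by apply/ffunP => j; rewrite !ffunE; case: eqP => // ->.
  over.
rewrite -(pair_big xpredT xpredT (fun h (x : C) => F h)) /= exchange_big /=.
by rewrite sumr_cardT.
Qed.

(** Here and in the next three lemmas denominators are cleared, so an empty [C] is no special case.
    Each lemma resamples one more position and falls back on the previous one. *)
Lemma sum_marginal1 (F : C -> R) i :
  c * \sum_(h : {ffun P -> C}) F (h i) = H * \sum_x F x.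
Proof.
rewrite -(sum_update (fun h => F (h i)) i).
under eq_bigr do under eq_bigr do rewrite update_same.
by rewrite sumr_cardT.
Qed.

Lemma sum_marginal2 (F : C -> C -> R) i j : i != j ->
  c ^+ 2 * \sum_(h : {ffun P -> C}) F (h i) (h j) = H * \sum_x \sum_y F x y.
Proof.
move=> nij; rewrite expr2 -mulrA -(sum_update (fun h => F (h i) (h j)) j).
rewrite exchange_big mulr_sumr /=.
under eq_bigr => y _.
  under eq_bigr => h _ do rewrite update_same update_neq//.
  rewrite (sum_marginal1 (fun x => F x y)); over.
by rewrite -mulr_sumr exchange_big.
Qed.

Lemma sum_marginal3 (F : C -> C -> C -> R) i j k : uniq [:: i; j; k] ->
  c ^+ 3 * \sum_(h : {ffun P -> C}) F (h i) (h j) (h k)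
  = H * \sum_x \sum_y \sum_z F x y z.
Proof.
rewrite /= !inE negb_or => /and3P[/andP[nij nik] njk _].
rewrite exprSr -mulrA -(sum_update (fun h => F (h i) (h j) (h k)) k).
rewrite exchange_big mulr_sumr /=.
under eq_bigr => z _.
  under eq_bigr => h _ do rewrite update_same !update_neq//.
  rewrite (sum_marginal2 (fun x y => F x y z))//; over.
rewrite -mulr_sumr exchange_big /=; congr (_ * _).
by apply: eq_bigr => x _; rewrite exchange_big.
Qed.

Lemma sum_marginal4 (F : C -> C -> C -> C -> R) i j k l :
  uniq [:: i; j; k; l] ->
  c ^+ 4 * \sum_(h : {ffun P -> C}) F (h i) (h j) (h k) (h l)
  = H * \sum_x \sum_y \sum_z \sum_t F x y z t.
Proof.
rewrite /= !inE !negb_or.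
move=> /and4P[/and3P[nij nik nil] /andP[njk njl] nkl _].
rewrite exprSr -mulrA -(sum_update (fun h => F (h i) (h j) (h k) (h l)) l).
rewrite exchange_big mulr_sumr /=.
under eq_bigr => t _.
  under eq_bigr => h _ do rewrite update_same !update_neq//.
  rewrite (sum_marginal3 (fun x y z => F x y z t)); last first.
    by rewrite /= !inE negb_or nij nik njk.
  over.
rewrite -mulr_sumr exchange_big /=; congr (_ * _).
apply: eq_bigr => x _; rewrite exchange_big; apply: eq_bigr => y _ /=.
by rewrite exchange_big.
Qed.

(** Union bound over ordered pairs of distinct positions, each colliding with probability
    [1 / c]. *)
Lemma card_not_injective :
  c * #|[set h : {ffun P -> C} | ~~ injectiveb h]|%:R <= H * #|P|%:R ^+ 2.
Proof.
have le1 : #|[set h : {ffun P -> C} | ~~ injectiveb h]|%:R <=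
    \sum_(i : P) \sum_(j | i != j) \sum_(h : {ffun P -> C}) (h i == h j)%:R :> R.
  under eq_bigr do rewrite exchange_big /=.
  rewrite exchange_big -sum1_card natr_sum big_mkcond /=.
  apply: ler_sum => h _; rewrite inE; case: injectiveP => /= [_|ninj].
    by apply: sumr_ge0 => i _; apply: sumr_ge0.
  have [i [j [nij eij]]] : exists i j, i != j /\ h i = h j.
    apply: contrapT => no; apply: ninj => i j eij; apply/eqP.
    by apply: contrapT => /negP nij; apply: no; exists i, j.
  rewrite (bigD1 i)//= (bigD1 j)//= eij eqxx -addrA lerDl addr_ge0//.
    exact: sumr_ge0.
  by apply: sumr_ge0 => ? _; apply: sumr_ge0.
have [c0|c0] := posnP #|C|.
  by rewrite c0 mul0r mulr_ge0// exprn_ge0.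
have cP : 0 < c by rewrite ltr0n.
rewrite -(ler_pM2l cP); apply: le_trans (_ : c ^+ 2 * _ <= _).
  rewrite mulrA -expr2; apply: ler_wpM2l le1; exact: exprn_ge0.
rewrite mulr_sumr.
have diag : \sum_(x : C) \sum_(y : C) (x == y)%:R = c.
  under eq_bigr => x _.
    rewrite (bigD1 x)//= eqxx big1 ?addr0; last first.
      by move=> y /negPf; rewrite eq_sym => ->.
    over.
  by rewrite sumr_const.
under eq_bigr => i _.
  rewrite mulr_sumr; under eq_bigr => j nij.
    rewrite (sum_marginal2 (fun x y => (x == y)%:R))// diag; over.
  over.
apply: le_trans (_ : \sum_(i : P) \sum_(j : P) H * c <= _).
  apply: ler_sum => i _; rewrite big_mkcond; apply: ler_sum => j _.
  by case: ifP => // _; rewrite mulr_ge0.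
rewrite !sumr_cardT expr2 le_eqVlt; apply/orP; left; apply/eqP.
by generalize H c (#|P|%:R : R) => u v w; ring.
Qed.

(* Chebyshev's inequality for the number [X] of edges between the images of [A]
   and [B]: the covariance of two position pairs vanishes unless they share a
   position, and the degree bound [D] controls the pairs sharing exactly one. *)
Lemma second_moment (E : rel C) (A B : {set P}) (D : nat) :
  [disjoint A & B] -> symmetric E ->
  (forall x, (\sum_y E x y <= D)%N) ->
  #|[set h : {ffun P -> C} | ~~ [exists i in A, exists j in B, E (h i) (h j)]]|%:R
    * (#|A| * #|B|)%:R * (\sum_x \sum_y (E x y)%:R)
  <= H * ((#|A| + #|B|)%:R * D%:R * c + c ^+ 2).
Proof.
move=> dAB symE degD.
set bad := [set h | _].
set a : R := #|A|%:R; set b : R := #|B|%:R.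
set e := \sum_x _; rewrite natrM natrD -/a -/b.
have e0 : 0 <= e by apply: sumr_ge0 => x _; apply: sumr_ge0.
have a0 : 0 <= a by []. have b0 : 0 <= b by []. have D0 : 0 <= D%:R :> R by [].
have H0 : 0 <= H by []. have c0 : 0 <= c by [].
have degR x : \sum_y (E x y)%:R <= D%:R :> R by rewrite -natr_sum ler_nat.
pose X h : R := \sum_(i in A) \sum_(j in B) (E (h i) (h j))%:R.
have nAB i j : i \in A -> j \in B -> i != j.
  move=> iA jB; apply: contraTneq iA => ->; apply/negP => jA.
  by move/pred0P: dAB => /(_ j) /=; rewrite jA jB.
have EX : c ^+ 2 * \sum_(h : {ffun P -> C}) X h = H * (a * b * e).
  rewrite exchange_big mulr_sumr /=.
  under eq_bigr => i iA.
    rewrite exchange_big mulr_sumr /=; under eq_bigr => j jB.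
      rewrite (sum_marginal2 (fun x y => (E x y)%:R)) ?nAB// -/e; over.
    over.
  rewrite !sumr_card -/a -/b.
  by generalize H a b e; intros; ring.
(* Paths of length two counted from their centre: each ordered edge extends in at most [D] ways. *)
have star : \sum_x \sum_y \sum_z (E x y && E x z)%:R <= D%:R * e.
  rewrite /e mulr_sumr; apply: ler_sum => x _.
  rewrite mulr_sumr; apply: ler_sum => y _.
  by case: (E x y) => /=; [rewrite mulr1|rewrite mulr0 big1].
(* The terms stand for disjoint pairs, a shared [i], a shared [j], and equal pairs. Every
   coincidence leaves one position fewer to average over, hence one spare factor [c]. *)
have cov i i' j j' : i \in A -> i' \in A -> j \in B -> j' \in B ->
    c ^+ 4 * \sum_(h : {ffun P -> C}) (E (h i) (h j) && E (h i') (h j'))%:R <=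
    H * (e ^+ 2 + (i == i')%:R * (c * D%:R * e) + (j == j')%:R * (c * D%:R * e)
         + (i == i')%:R * (j == j')%:R * (c ^+ 2 * e)).
  move=> iA i'A jB j'B.
  have [eii|nii] := eqVneq i i'; have [ejj|njj] := eqVneq j j'.
  - subst i' j'; under eq_bigr do rewrite andbb.
    rewrite (_ : 4 = 2 + 2)%N// exprD -mulrA.
    rewrite (sum_marginal2 (fun x y => (E x y)%:R)) ?nAB// -/e.
    rewrite mulrCA; apply: ler_wpM2l => //; rewrite !mul1r lerDr.
    by rewrite !addr_ge0 ?exprn_ge0 ?mulr_ge0.
  - subst i'; rewrite exprS -mulrA.
    rewrite (sum_marginal3 (fun x y z => (E x y && E x z)%:R)); last first.
      by rewrite /= !inE negb_or njj !nAB//.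
    rewrite mulrCA; apply: ler_wpM2l => //; rewrite !mul1r !mul0r !addr0.
    apply: le_trans (_ : c * (D%:R * e) <= _); first exact: ler_wpM2l.
    by rewrite mulrA lerDr exprn_ge0.
  - subst j'; rewrite exprS -mulrA.
    (* Symmetry of [E] moves the shared endpoint to the centre of the star. *)
    under eq_bigr do rewrite symE [E _ (_ j)]symE.
    rewrite (sum_marginal3 (fun x y z => (E x y && E x z)%:R) (i := j)); last first.
      by rewrite /= !inE negb_or ![j == _]eq_sym nii !nAB//.
    rewrite mulrCA; apply: ler_wpM2l => //; rewrite !mul1r !mul0r !addr0.
    apply: le_trans (_ : c * (D%:R * e) <= _); first exact: ler_wpM2l.
    by rewrite mulrA lerDr exprn_ge0.
  - rewrite (sum_marginal4 (fun x y z t => (E x y && E z t)%:R)); last first.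
      by rewrite /= !inE !negb_or nii njj [j == i']eq_sym !nAB//.
    apply: ler_wpM2l => //; rewrite !mul0r !addr0 expr2 /e le_eqVlt; apply/orP; left.
    apply/eqP; rewrite mulr_suml; apply: eq_bigr => x _.
    rewrite mulr_suml; apply: eq_bigr => y _.
    rewrite mulr_sumr; apply: eq_bigr => z _.
    rewrite mulr_sumr; apply: eq_bigr => t _.
    by rewrite -natrM mulnb.
have EX2 : c ^+ 4 * \sum_(h : {ffun P -> C}) X h ^+ 2 <=
    H * (a ^+ 2 * b ^+ 2 * e ^+ 2 + a * b * (a + b) * (c * D%:R * e)
         + a * b * (c ^+ 2 * e)).
  have -> : \sum_(h : {ffun P -> C}) X h ^+ 2 =
      \sum_(i in A) \sum_(i' in A) \sum_(j in B) \sum_(j' in B)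
      \sum_(h : {ffun P -> C}) (E (h i) (h j) && E (h i') (h j'))%:R.
    under [RHS]eq_bigr do under eq_bigr do under eq_bigr do rewrite exchange_big /=.
    under [RHS]eq_bigr do under eq_bigr do rewrite exchange_big /=.
    under [RHS]eq_bigr do rewrite exchange_big /=.
    rewrite [RHS]exchange_big /=; apply: eq_bigr => h _.
    rewrite expr2 mulr_suml; apply: eq_bigr => i _.
    rewrite mulr_sumr; apply: eq_bigr => i' _.
    rewrite mulr_suml; apply: eq_bigr => j _.
    rewrite mulr_sumr; apply: eq_bigr => j' _.
    by rewrite -natrM mulnb.
  pose T i i' j j' := H * (e ^+ 2 + (i == i')%:R * (c * D%:R * e)
    + (j == j')%:R * (c * D%:R * e) + (i == i')%:R * (j == j')%:R * (c ^+ 2 * e)).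
  apply: le_trans (_ : \sum_(i in A) \sum_(i' in A) \sum_(j in B)
      \sum_(j' in B) T i i' j j' <= _).
    do 4 ![rewrite mulr_sumr; apply: ler_sum => ? ?].
    exact: cov.
  have delta (S : {set P}) (i : P) : i \in S -> \sum_(i' in S) (i == i')%:R = 1 :> R.
    move=> iS; rewrite (bigD1 i)//= eqxx big1 ?addr0// => j /andP[_ /negPf].
    by rewrite eq_sym => ->.
  have sumB i i' : \sum_(j in B) \sum_(j' in B) T i i' j j' =
      H * (b ^+ 2 * e ^+ 2 + (i == i')%:R * (b ^+ 2 * (c * D%:R * e))
      + b * (c * D%:R * e) + (i == i')%:R * (b * (c ^+ 2 * e))).
    under eq_bigr => j jB.
      rewrite -mulr_sumr !big_split /= -!mulr_suml -mulr_sumr !delta//.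
      rewrite !sumr_card; over.
    rewrite -mulr_sumr !big_split /= !sumr_card -/b.
    by generalize H c a b e (D%:R : R); intros; ring.
  under eq_bigr => i iA.
    under eq_bigr do rewrite sumB.
    rewrite -mulr_sumr !big_split /= -!mulr_suml !delta// !sumr_card.
    over.
  rewrite -mulr_sumr !big_split /= !sumr_card -/a.
  rewrite le_eqVlt; apply/orP; left; apply/eqP.
  by generalize H c a b e (D%:R : R); intros; ring.
(* On a bad sample [X h = 0], so the deviation from the scaled mean [a * b * e] is the whole
   mean. *)
have low : #|bad|%:R * (a * b * e) ^+ 2 <=
    \sum_(h : {ffun P -> C}) (c ^+ 2 * X h - a * b * e) ^+ 2.
  rewrite -sum1_card natr_sum mulr_suml big_mkcond /=; apply: ler_sum => h _.
  case: ifP => [|_]; last exact: sqr_ge0.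
  rewrite inE negb_exists => /forallP noE.
  rewrite (_ : X h = 0) ?mulr0 ?sub0r ?sqrrN ?mul1r//.
  apply: big1 => i iA; apply: big1 => j jB.
  have := noE i; rewrite negb_and iA /= negb_exists => /forallP/(_ j).
  by rewrite negb_and jB /= => /negPf ->.
have var : \sum_(h : {ffun P -> C}) (c ^+ 2 * X h - a * b * e) ^+ 2 <=
    (a * b * e) * (H * ((a + b) * D%:R * c + c ^+ 2)).
  have -> : \sum_(h : {ffun P -> C}) (c ^+ 2 * X h - a * b * e) ^+ 2 =
      c ^+ 4 * \sum_(h : {ffun P -> C}) X h ^+ 2
      - 2 * (a * b * e) * (c ^+ 2 * \sum_(h : {ffun P -> C}) X h)
      + H * (a * b * e) ^+ 2.
    under eq_bigr => h _.
      rewrite (_ : _ ^+ 2 = c ^+ 4 * X h ^+ 2 - 2 * (a * b * e) * (c ^+ 2 * X h)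
        + (a * b * e) ^+ 2); last by generalize (X h) a b e c; intros; ring.
      over.
    rewrite !big_split /= sumr_cardT sumrN -!mulr_sumr.
    by [].
  rewrite EX; apply: le_trans (lerD (lerD EX2 (lexx _)) (lexx _)) _.
  rewrite le_eqVlt; apply/orP; left; apply/eqP.
  by generalize H c a b e (D%:R : R); intros; ring.
have [abe0|abeN0] := eqVneq (a * b * e) 0.
  rewrite -mulrA abe0 mulr0 mulr_ge0// addr_ge0 ?exprn_ge0// !mulr_ge0//.
  exact: addr_ge0.
have abeP : 0 < a * b * e by rewrite lt_def abeN0 !mulr_ge0.
rewrite -(ler_pM2l abeP); apply: le_trans (le_trans low var).
rewrite le_eqVlt; apply/orP; left; apply/eqP.
by generalize H c a b e (D%:R : R); intros; ring.
Qed.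

End RandomFunction.

(** * Embeddings and signed blocks *)

Section Embedding.
Variable R : realType.
Implicit Types (eps : R) (m n d k : nat).

Definition gram m n (A : 'M[R]_(m, n)) (a b : 'I_n) : R :=
  \sum_r A r a * A r b.

Lemma gramE m n (A : 'M[R]_(m, n)) a b : gram A a b = (A^T *m A) a b.
Proof. by rewrite mxE; apply: eq_bigr => r _; rewrite mxE. Qed.

Lemma gramC m n (A : 'M[R]_(m, n)) a b : gram A a b = gram A b a.
Proof. by apply: eq_bigr => r _; rewrite mulrC. Qed.

Lemma gram_le_mean m n (A : 'M[R]_(m, n)) a b :
  2 * gram A a b <= gram A a a + gram A b b.
Proof.
rewrite mulr_sumr -big_split /=; apply: ler_sum => r _.
by have := sqr_ge0 (A r a - A r b); lra.
Qed.

(** The event inside [subspace_embedding]; both unfold to the same term, so the hypothesis of the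
    theorem applies directly. *)
Definition embeds m n d eps (Pi : 'M[R]_(m, n)) (U : 'M[R]_(n, d)) : Prop :=
  forall x : 'cV[R]_d, (1 - eps) * norm2 (U *m x) <= norm2 (Pi *m U *m x)
    /\ norm2 (Pi *m U *m x) <= (1 + eps) * norm2 (U *m x).

Lemma sqr_norm2 n (x : 'cV[R]_n) : norm2 x ^+ 2 = \sum_i x i 0 ^+ 2.
Proof. by rewrite sqr_sqrtr// sumr_ge0// => i _; exact: sqr_ge0. Qed.

Lemma embeds_sqr m n d eps (Pi : 'M[R]_(m, n)) (U : 'M[R]_(n, d)) x :
  0 < eps < 1 -> embeds eps Pi U ->
  (1 - eps) ^+ 2 * norm2 (U *m x) ^+ 2 <= norm2 (Pi *m U *m x) ^+ 2
  <= (1 + eps) ^+ 2 * norm2 (U *m x) ^+ 2.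
Proof.
move=> /andP[e0 e1] /(_ x)[lo up]; rewrite -!exprMn.
by rewrite !ler_sqr ?nnegrE ?lo ?up ?mulr_ge0 ?sqrtr_ge0//; lra.
Qed.

Lemma norm2_col m d (A : 'M[R]_(m, d)) i :
  norm2 (A *m delta_mx i 0) ^+ 2 = gram A i i.
Proof.
rewrite sqr_norm2; apply: eq_bigr => r _.
by rewrite -colE mxE expr2.
Qed.

Lemma norm2_colD m d (A : 'M[R]_(m, d)) i j (c : R) : c ^+ 2 = 1 ->
  norm2 (A *m (delta_mx i 0 + c *: delta_mx j 0)) ^+ 2
  = gram A i i + gram A j j + 2 * c * gram A i j.
Proof.
move=> c1; rewrite sqr_norm2 mulr_sumr -!big_split; apply: eq_bigr => r _ /=.
rewrite mulmxDr -scalemxAr -!colE !mxE sqrrD exprMn c1 mul1r !expr2 -mulr_natl.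
by move: (A r i) (A r j) => u v; ring.
Qed.

Lemma embeds_col m n d eps (Pi : 'M[R]_(m, n)) (U : 'M[R]_(n, d)) i :
  0 < eps < 1 -> embeds eps Pi U -> gram U i i = 1 ->
  (1 - eps) ^+ 2 <= gram (Pi *m U) i i <= (1 + eps) ^+ 2.
Proof.
move=> he hU Uii; have := embeds_sqr (delta_mx i 0) he hU.
by rewrite !norm2_col Uii !mulr1.
Qed.

(** Polarization: [e_i + e_j] and [e_i - e_j] both have image of squared norm 2 under [U], and their
    sketched squared norms differ by four times the inner product. *)
Lemma embeds_gram m n d eps (Pi : 'M[R]_(m, n)) (U : 'M[R]_(n, d)) i j :
  0 < eps < 1 -> embeds eps Pi U ->
  gram U i i = 1 -> gram U j j = 1 -> gram U i j = 0 ->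
  `|gram (Pi *m U) i j| <= 2 * eps.
Proof.
move=> he hU Uii Ujj Uij.
have := embeds_sqr (delta_mx i 0 + 1 *: delta_mx j 0) he hU.
have := embeds_sqr (delta_mx i 0 + (-1) *: delta_mx j 0) he hU.
rewrite !norm2_colD ?sqrrN ?expr1n// Uii Ujj Uij.
move=> /andP[lo1 up1] /andP[lo2 up2]; rewrite ler_norml; apply/andP; split; lra.
Qed.

End Embedding.

Lemma unif_prC (R : realType) (T : finType) (A : set T) : (0 < #|T|)%N ->
  unif_pr A = 1 - #|[set w | ~~ `[< A w >]]|%:R / #|T|%:R :> R.
Proof.
move=> T0; rewrite /unif_pr; set S := [set w | `[< A w >]].
rewrite (_ : [set w | ~~ _] = ~: S); last by apply/setP => w; rewrite !inE.
apply/eqP; rewrite eq_sym subr_eq -mulrDl -natrD cardsC divff//.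
by rewrite pnatr_eq0 -lt0n.
Qed.

(** * Failure probability of one level in the presence of close pairs *)

Section Blocks.
Variables (R : realType) (n d k : nat).
Hypothesis k_gt0 : (0 < k)%N.
Implicit Types (h : {ffun 'I_(d * k) -> 'I_n}) (s : {ffun 'I_(d * k) -> bool}).

Lemma block_subproof (j : 'I_(d * k)) : (j %/ k < d)%N.
Proof. by rewrite ltn_divLR. Qed.

Definition block (j : 'I_(d * k)) : 'I_d := Ordinal (block_subproof j).

Lemma in_block (j : 'I_(d * k)) (i : 'I_d) :
  (i * k <= j < i.+1 * k)%N = (block j == i).
Proof.
rewrite -leq_divRL// -ltn_divLR// ltnS -eqn_leq eq_sym.
by apply/eqP/eqP => [e|<-//]; apply/val_inj.
Qed.

Lemma card_block (i : 'I_d) : #|[pred j | block j == i]| = k.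
Proof.
rewrite -sum1_card.
under eq_bigl do rewrite inE -in_block.
rewrite -(big_ord_widen_cond (d * k) (fun j => i * k <= j)%N (fun=> 1%N)); last first.
  by rewrite leq_mul2r ltn_ord orbT.
apply: etrans (esym (big_geq_mkord (i * k) (i.+1 * k) predT (fun=> 1%N))) _.
by rewrite sum_nat_const_nat muln1 mulSn addnK.
Qed.

Lemma WmxE s j i :
  Wmx s j i = if block j == i then (-1) ^+ s j * Num.sqrt (k%:R^-1) else 0 :> R.
Proof. by rewrite mxE in_block. Qed.

(** Distinct columns of [W] have disjoint supports, and each has [k] entries of square [1 / k]. *)
Lemma gram_Wmx s i i' : gram (Wmx s) i i' = (i == i')%:R :> R.
Proof.
rewrite /gram; have [<-|nii] := eqVneq i i'.
  under eq_bigr do rewrite WmxE.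
  rewrite (bigID (fun j => block j == i)) /= addrC big1 ?add0r; last first.
    by move=> j /negPf ->; rewrite mul0r.
  under eq_bigr => j ->.
    rewrite mulrACA -expr2 sqrr_sign -expr2 sqr_sqrtr ?invr_ge0// mul1r; over.
  rewrite (sumr_card [pred j | block j == i]) card_block divff//.
  by rewrite pnatr_eq0 -lt0n.
apply: big1 => j _; rewrite !WmxE; case: eqP => [->|]; last by rewrite mul0r.
by rewrite (negPf nii) mulr0.
Qed.

(** For injective [h] the columns of [V] are orthonormal, so [U] inherits the Gram matrix of [W]. *)
Lemma gram_U h s i i' : injective h ->
  gram (Vmx h *m Wmx s) i i' = (i == i')%:R :> R.
Proof.
move=> hinj; rewrite -(gram_Wmx s) !gramE trmx_mul mulmxA -[_ *m _ *m Vmx h]mulmxA.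
rewrite (_ : _ *m Vmx h = 1%:M) ?mulmx1//; apply/matrixP => j j'.
rewrite !mxE (bigD1 (h j))//= !mxE eqxx big1; last first.
  by move=> r /negPf nr; rewrite !mxE nr mul0r.
by rewrite addr0 mul1r (inj_eq hinj).
Qed.

Definition flip (i : 'I_(d * k)) s : {ffun 'I_(d * k) -> bool} :=
  [ffun j => s j (+) (j == i)].

Lemma flipK i : involutive (flip i).
Proof. by move=> s; apply/ffunP => j; rewrite !ffunE addbK. Qed.

Section Fail.
Variables (m : nat) (Pi : 'M[R]_(m, n)) (eps : R).
Hypothesis eps_bounds : 0 < eps < 1.

Lemma sketch_flip h s i r b :
  (Pi *m (Vmx h *m Wmx (flip i s))) r b =
  (Pi *m (Vmx h *m Wmx s)) r b - 2 * Wmx s i b * Pi r (h i).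
Proof.
have E s' : (Pi *m (Vmx h *m Wmx s')) r b = \sum_j Pi r (h j) * Wmx s' j b.
  rewrite mulmxA mxE; apply: eq_bigr => j _; congr (_ * _).
  rewrite mxE (bigD1 (h j))//= mxE eqxx mulr1 big1 ?addr0// => a /negPf na.
  by rewrite mxE na mulr0.
rewrite !E (bigD1 i)//= [in RHS](bigD1 i)//=.
rewrite [X in _ + X](eq_bigr (fun j => Pi r (h j) * Wmx s j b)); last first.
  by move=> j /negPf nj; rewrite !WmxE ffunE nj addbF.
rewrite !WmxE ffunE eqxx addbT.
case: ifP => _; last by rewrite !(mulr0, mul0r, subr0).
case: (s i); rewrite /= ?expr0 ?expr1; 
  move: (Num.sqrt _) (Pi r (h i)) (\sum_(_ | _) _) => u v w; ring.
Qed.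

(* Flipping the signs at [i] and [j] isolates the contribution of the pair
   [(h i, h j)] to the inner product of the two blocks. *)
Lemma some_flip_fails h s i j : injective h -> block i != block j ->
  2 * eps * k%:R < gram Pi (h i) (h j) ->
  ~ [/\ embeds eps Pi (Vmx h *m Wmx s), embeds eps Pi (Vmx h *m Wmx (flip i s)),
        embeds eps Pi (Vmx h *m Wmx (flip j s)) &
        embeds eps Pi (Vmx h *m Wmx (flip j (flip i s)))].
Proof.
move=> hinj nij big [e1 e2 e3 e4].
pose Z s' := Pi *m (Vmx h *m Wmx s').
have small s' : embeds eps Pi (Vmx h *m Wmx s') ->
    `|gram (Z s') (block i) (block j)| <= 2 * eps.
  by move=> es'; apply: embeds_gram; rewrite ?gram_U ?eqxx ?(negPf nij).
have Wij s' : Wmx s' i (block j) = 0 :> R by rewrite WmxE (negPf nij).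
have Wji s' : Wmx s' j (block i) = 0 :> R by rewrite WmxE eq_sym (negPf nij).
have neq : (j == i) = false by apply: contraNF nij => /eqP ->.
have Wjj : Wmx (flip i s) j (block j) = Wmx s j (block j) :> R.
  by rewrite !WmxE ffunE neq addbF.
(* Mixed second difference in the two signs: only the product of the two flipped terms survives. *)
have key : gram (Z s) (block i) (block j) - gram (Z (flip i s)) (block i) (block j)
    - gram (Z (flip j s)) (block i) (block j)
    + gram (Z (flip j (flip i s))) (block i) (block j)
    = 4 * (Wmx s i (block i) * Wmx s j (block j)) * gram Pi (h i) (h j).
  rewrite mulr_sumr -!sumrB -big_split; apply: eq_bigr => r _ /=.
  have fi b : Z (flip i s) r b = _ := sketch_flip h s i r b.
  have fj b : Z (flip j s) r b = _ := sketch_flip h s j r b.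
  have fij b : Z (flip j (flip i s)) r b = _ := sketch_flip h (flip i s) j r b.
  rewrite !fij !fj -!/(Z (flip i s)) !fi -!/(Z s) (Wij s) (Wji s) (Wji (flip i s)) Wjj.
  move: (Z s r (block i)) (Z s r (block j)).
  move: (Wmx s i _) (Wmx s j _) (Pi r (h i)) (Pi r (h j)) => *; ring.
(* The product of the two entries of [W] has modulus [1 / k], so the right side exceeds [8 * eps],
   while four inner products of modulus at most [2 * eps] cannot. *)
have := f_equal Num.norm key.
rewrite !normrM !WmxE !eqxx !normrM !normr_sign !mul1r (ger0_norm (sqrtr_ge0 _)).
rewrite -expr2 sqr_sqrtr ?invr_ge0// ger0_norm//.
have k0 : 0 < k%:R :> R by rewrite ltr0n.
have g0 : 2 * eps < k%:R^-1 * gram Pi (h i) (h j).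
  by rewrite [X in _ < X]mulrC ltr_pdivlMr.
have lg : k%:R^-1 * gram Pi (h i) (h j) <= k%:R^-1 * `|gram Pi (h i) (h j)|.
  by rewrite ler_wpM2l ?invr_ge0 ?ler_norm.
have := small _ e1; have := small _ e2; have := small _ e3; have := small _ e4.
move: (gram (Z _) _ _) (gram (Z _) _ _) (gram (Z _) _ _) (gram (Z _) _ _).
move=> x y z t; rewrite !ler_norml => /andP[? ?] /andP[? ?] /andP[? ?] /andP[? ?] H.
have : `|x - y - z + t| <= 8 * eps by rewrite ler_norml; apply/andP; split; lra.
by rewrite H; lra.
Qed.

(** Double counting: among the four sign vectors obtained from any [s] at least one fails, and each
    failing vector is reached four times. *)
Lemma card_fail h i j : injective h -> block i != block j ->
  2 * eps * k%:R < gram Pi (h i) (h j) ->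
  (#|{ffun 'I_(d * k) -> bool}|
    <= 4 * #|[set s | ~~ `[< embeds eps Pi (Vmx h *m Wmx s) >]]|)%N.
Proof.
move=> hinj nij big; set F := [set s | _].
have cF f : involutive f -> (\sum_(s : {ffun 'I_(d * k) -> bool}) (f s \in F))%N = #|F|.
  move=> fK; rewrite (reindex_inj (inv_inj fK)) -sum1_card [RHS]big_mkcond /=.
  by apply: eq_bigr => s _; rewrite fK; case: (s \in F).
have -> : (4 * #|F| = \sum_(s : {ffun 'I_(d * k) -> bool}) ((s \in F)
     + (flip i s \in F) + (flip j s \in F) + (flip j (flip i s) \in F)))%N.
  have cij : (\sum_(s : {ffun 'I_(d * k) -> bool}) (flip j (flip i s) \in F))%N = #|F|.
    rewrite -(cF _ (flipK j)) (reindex_inj (inv_inj (flipK i))).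
    by apply: eq_bigr => s _; rewrite flipK.
  rewrite !big_split /= (cF id)// (cF _ (flipK i)) (cF _ (flipK j)) cij.
  by rewrite !mulSn addn0 !addnA.
rewrite -sum1_card; apply: leq_sum => s _.
rewrite !inE; have := @some_flip_fails h s i j hinj nij big.
case: asboolP => // ?; case: asboolP => // ?.
case: asboolP => // ?; case: asboolP => // ?.
by case.
Qed.

(** For each fixed [h] that is injective and hits [E] across two blocks, at least a quarter of the
    sign vectors fail. *)
Lemma D_beta_fail (E : rel 'I_n) :
  (forall a b, E a b -> 2 * eps * k%:R < gram Pi a b) ->
  D_beta k [set U : 'M[R]_(n, d) | embeds eps Pi U]%classic <=
  1 - #|[set h : {ffun 'I_(d * k) -> 'I_n} | injectiveb h
          & [exists i, exists j, (block i != block j) && E (h i) (h j)]]|%:R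
      / (4 * #|{ffun 'I_(d * k) -> 'I_n}|%:R).
Proof.
move=> Ebig; set G := [set h | _ & _].
(* With no sample at all, division by zero makes the probability 0 and the bound 1. *)
have [T0|T0] := posnP #|{ffun 'I_(d * k) -> 'I_n}|.
  rewrite /D_beta /unif_pr card_prod T0 mul0n mulr0 invr0 !mulr0 subr0.
  exact: ler01.
have B0 : (0 < #|{ffun 'I_(d * k) -> bool}|)%N by apply/card_gt0P; exists [ffun=> true].
rewrite /D_beta unif_prC ?card_prod ?muln_gt0 ?T0//; set F := [set w | _].
have : (#|G| * #|{ffun 'I_(d * k) -> bool}| <= 4 * #|F|)%N.
  rewrite -sum1_card big_distrl /= (_ : #|F| =
      \sum_(h : {ffun 'I_(d * k) -> 'I_n}) \sum_(s : {ffun 'I_(d * k) -> bool})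
      ((h, s) \in F))%N; last first.
    rewrite pair_bigA /= -sum1_card big_mkcond /=; apply: eq_bigr => -[h s] _ /=.
    by case: (_ \in _).
  rewrite big_distrr big_mkcond /=; apply: leq_sum => h _; case: ifP => // hG.
  move: hG; rewrite inE => /andP[/injectiveP hinj].
  move=> /existsP[i /existsP[j /andP[nij Eij]]].
  rewrite mul1n; apply: leq_trans (card_fail hinj nij (Ebig _ _ Eij)) _.
  rewrite leq_mul2l /= -sum1_card big_mkcond /=; apply: leq_sum => s _.
  by rewrite !inE; case: asboolP.
rewrite -(ler_nat R) !natrM.
have h0 : 0 < #|{ffun 'I_(d * k) -> 'I_n}|%:R :> R by rewrite ltr0n.
have b0 : 0 < #|{ffun 'I_(d * k) -> bool}|%:R :> R by rewrite ltr0n.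
move: h0 b0; move: (#|F|%:R : R) (#|G|%:R : R) => x y.
move: (#|{ffun 'I_(d * k) -> 'I_n}|%:R : R) (#|{ffun 'I_(d * k) -> bool}|%:R : R).
move=> u v u0 v0 le_yx.
rewrite lerD2l lerN2 ler_pdivrMr ?mulr_gt0// mulrAC ler_pdivlMr ?mulr_gt0//.
by rewrite -(ler_pM2r u0) in le_yx; lra.
Qed.

End Fail.
End Blocks.

(** * Heavy columns and groups *)

Section Columns.
Variables (R : realType) (m n : nat) (Pi : 'M[R]_(m, n)) (eps : R).

Definition good_column (a : 'I_n) : bool :=
  (1 - eps) ^+ 2 <= gram Pi a a <= (1 + eps) ^+ 2.

(** Under [D_1] the first column of [Pi *m U] is, up to sign, a uniformly random column of [Pi]. *)
Lemma good_columns d : 0 < eps < 1 -> (0 < d)%N -> (0 < n)%N ->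
  n%:R * D_beta 1 [set U : 'M[R]_(n, d) | embeds eps Pi U]%classic
  <= #|[set a | good_column a]|%:R.
Proof.
move=> he d0 n0.
have d1 : (0 < d * 1)%N by rewrite muln1.
pose j0 : 'I_(d * 1) := Ordinal d1; pose i0 := block (ltn0Sn 0) j0.
have Wi0 (s : {ffun 'I_(d * 1) -> bool}) j :
    Wmx s j i0 = (j == j0)%:R * (-1) ^+ s j :> R.
  rewrite (WmxE _ (ltn0Sn 0)) -val_eqE /= !divn1 -[j == j0]val_eqE /=.
  by case: eqP; rewrite ?invr1 ?sqrtr1 ?mulr1 ?mul1r ?mul0r.
have Ui0 h s r : (Vmx h *m Wmx s) r i0 = (r == h j0)%:R * (-1) ^+ s j0 :> R.
  rewrite mxE (bigD1 j0)//= Wi0 eqxx mul1r mxE big1 ?addr0// => j /negPf nj.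
  by rewrite Wi0 nj mul0r mulr0.
have col h s : embeds eps Pi (Vmx h *m Wmx s) -> good_column (h j0).
  move=> hU; have := embeds_col he hU (i := i0).
  have -> : gram (Vmx h *m Wmx s) i0 i0 = 1 :> R.
    rewrite /gram (bigD1 (h j0))//= Ui0 eqxx mul1r -expr2 sqrr_sign big1 ?addr0//.
    by move=> r /negPf nr; rewrite Ui0 nr !mul0r.
  have -> : gram (Pi *m (Vmx h *m Wmx s)) i0 i0 = gram Pi (h j0) (h j0).
    have E r : (Pi *m (Vmx h *m Wmx s)) r i0 = Pi r (h j0) * (-1) ^+ s j0.
      rewrite mxE (bigD1 (h j0))//= Ui0 eqxx mul1r big1 ?addr0// => a /negPf na.
      by rewrite Ui0 na mul0r mulr0.
    by apply: eq_bigr => r _; rewrite !E mulrACA -!expr2 sqrr_sign mulr1 expr2.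
  by move=> /(_ erefl).
set bS := #|{ffun 'I_(d * 1) -> bool}|; set hS := #|{ffun 'I_(d * 1) -> 'I_n}|.
have b0 : 0 < bS%:R :> R by rewrite ltr0n; apply/card_gt0P; exists [ffun=> true].
have h0 : 0 < hS%:R :> R.
  by rewrite ltr0n; apply/card_gt0P; exists [ffun=> Ordinal n0].
rewrite /D_beta /unif_pr card_prod natrM mulrA ler_pdivrMr ?mulr_gt0//.
set S := [set w | _].
have cS : #|S|%:R <= bS%:R * \sum_(h : {ffun 'I_(d * 1) -> 'I_n})
    (good_column (h j0))%:R :> R.
  apply: le_trans (_ : \sum_(h : {ffun 'I_(d * 1) -> 'I_n})
      \sum_(s : {ffun 'I_(d * 1) -> bool}) (good_column (h j0))%:R <= _); last first.
    by under eq_bigr do rewrite sumr_cardT; rewrite -mulr_sumr.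
  rewrite pair_bigA /= -sum1_card natr_sum big_mkcond /=; apply: ler_sum => -[h s] _.
  by rewrite inE; case: asboolP => //= /col ->.
have := sum_marginal1 (fun a => (good_column a)%:R : R) j0.
have -> : \sum_(a < n) (good_column a)%:R = #|[set a | good_column a]|%:R :> R.
  rewrite -sum1_card natr_sum [RHS]big_mkcond /=; apply: eq_bigr => a _.
  by rewrite inE; case: good_column.
rewrite card_ord -/hS => eG.
apply: le_trans (_ : n%:R * (bS%:R * _) <= _); first exact: ler_wpM2l cS.
rewrite mulrCA eG; move: (hS%:R : R) (bS%:R : R) (#|_|%:R : R) => x y z.
by rewrite le_eqVlt; apply/orP; left; apply/eqP; ring.
Qed.

(** Otherwise the squared norm is at most [8 * eps / (9 * eps) = 8 / 9], which is below
    [(31 / 32) ^+ 2]. *)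
Lemma heavy_entry a : 0 < eps <= 1 / 32 ->
  (col_sparsity Pi)%:R <= 1 / (9 * eps) -> good_column a ->
  exists r, 8 * eps <= Pi r a ^+ 2.
Proof.
move=> /andP[e0 e1] sp /andP[lo _]; apply: contrapT => no.
have light r : Pi r a ^+ 2 <= 8 * eps.
  by rewrite leNgt; apply/negP => /ltW h; apply: no; exists r.
have : gram Pi a a <= (col_sparsity Pi)%:R * (8 * eps).
  apply: le_trans (_ : #|[set r | Pi r a != 0]|%:R * (8 * eps) <= _); last first.
    apply: ler_wpM2r; first by lra.
    by rewrite ler_nat /col_sparsity; apply: leq_bigmax.
  rewrite -sumr_card [X in _ <= X]big_mkcond; apply: ler_sum => r _.
  rewrite inE -expr2; case: eqP => [->|_]; first by rewrite expr0n.
  exact: light.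
have : (col_sparsity Pi)%:R * (9 * eps) <= 1 by rewrite -ler_pdivlMr//; lra.
by nra.
Qed.

Lemma gram_le2 a b : 0 < eps <= 1 / 32 -> good_column a -> good_column b ->
  gram Pi a b <= 2.
Proof.
move=> /andP[e0 e1] /andP[_ ua] /andP[_ ub]; have := gram_le_mean Pi a b.
by nra.
Qed.

End Columns.

(** * Pairs of columns with a common key *)

Section Groups.
Variables (R : realType) (C K : finType) (G : {set C}) (key : C -> K).

Definition same_group (a b : C) : bool := [&& a \in G, b \in G & key a == key b].
Definition group_size (x : K) : nat := #|[set a in G | key a == x]|.
Definition group_pairs : R := \sum_a \sum_b (same_group a b)%:R.

Local Notation ind x a := (((a \in G) && (key a == x))%:R : R).

Lemma same_groupE a b :
  (same_group a b)%:R = \sum_x ind x a * ind x b :> R.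
Proof.
rewrite (bigD1 (key a))//= eqxx andbT big1 ?addr0; last first.
  by move=> x /negPf; rewrite eq_sym => ->; rewrite andbF mul0r.
by rewrite -natrM mulnb /same_group eq_sym [key b == _]eq_sym.
Qed.

Lemma group_sizeE x : (group_size x)%:R = \sum_a ind x a :> R.
Proof.
rewrite /group_size -sum1_card natr_sum big_mkcond; apply: eq_bigr => a _.
by rewrite inE; case: (_ && _).
Qed.

Lemma sum_same_group (F : C -> C -> R) :
  \sum_a \sum_b (same_group a b)%:R * F a b
  = \sum_x \sum_a \sum_b ind x a * ind x b * F a b.
Proof.
rewrite [RHS]exchange_big; apply: eq_bigr => a _.
rewrite [RHS]exchange_big; apply: eq_bigr => b _.
by rewrite same_groupE mulr_suml.
Qed.

Lemma group_pairsE : group_pairs = \sum_x (group_size x)%:R ^+ 2.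
Proof.
rewrite /group_pairs; under eq_bigr do under eq_bigr do rewrite -[_%:R]mulr1.
rewrite (sum_same_group (fun _ _ => 1)); apply: eq_bigr => x _.
rewrite group_sizeE expr2 mulr_suml; apply: eq_bigr => a _.
by rewrite mulr_sumr; apply: eq_bigr => b _; rewrite mulr1.
Qed.

(** Cauchy-Schwarz for the group sizes, obtained by expanding the variance of the sizes around their
    mean. *)
Lemma group_pairs_ge : #|G|%:R ^+ 2 <= #|K|%:R * group_pairs.
Proof.
have sumG : \sum_x (group_size x)%:R = #|G|%:R :> R.
  under eq_bigr do rewrite group_sizeE.
  rewrite exchange_big -sum1_card natr_sum [RHS]big_mkcond; apply: eq_bigr => a _.
  rewrite (bigD1 (key a))//= eqxx andbT big1 ?addr0; first by case: (a \in G).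
  by move=> x /negPf; rewrite eq_sym => ->; rewrite andbF.
have [K0|K0] := posnP #|K|.
  have /card0_eq e := K0.
  suff -> : #|G| = 0%N by rewrite expr0n K0 mul0r.
  by apply: eq_card0 => a; have := e (key a); rewrite inE.
have : 0 <= \sum_x (#|K|%:R * (group_size x)%:R - #|G|%:R) ^+ 2 :> R.
  by apply: sumr_ge0 => x _; exact: sqr_ge0.
have sq (k g s : R) : (k * s - g) ^+ 2 = k ^+ 2 * s ^+ 2 - 2 * k * g * s + g ^+ 2.
  by ring.
under eq_bigr do rewrite sq.
rewrite big_split big_split /= sumrN sumr_cardT -!mulr_sumr -group_pairsE sumG.
have : 0 < #|K|%:R :> R by rewrite ltr0n.
move: (#|K|%:R : R) (#|G|%:R : R) group_pairs => k g q k0 H.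
by rewrite -subr_ge0 -(pmulr_rge0 _ k0); lra.
Qed.

Lemma group_size_le x : (group_size x)%:R ^+ 2 <= group_pairs.
Proof.
rewrite group_pairsE (bigD1 x)//= lerDl; apply: sumr_ge0 => y _.
exact: exprn_ge0.
Qed.

Lemma same_group_degree a : (\sum_b same_group a b <= \max_x group_size x)%N.
Proof.
apply: leq_trans (_ : group_size (key a) <= _)%N; last exact: leq_bigmax.
rewrite /group_size -sum1_card [X in (_ <= X)%N]big_mkcond; apply: leq_sum => b _.
rewrite inE /same_group [key b == _]eq_sym.
case: (a \in G); case: (b \in G); case: (_ == _) => //=.
Qed.

End Groups.

(* Within a group the columns share a row on which all entries are large and of
   the same sign, so the squared norm of their sum is large. *)
Lemma gram_energy (R : realType) m n (Pi : 'M[R]_(m, n)) (t : R) (G : {set 'I_n})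
    (key : 'I_n -> 'I_m * bool) : 0 < t ->
  (forall a, a \in G -> t <= Pi (key a).1 a ^+ 2) ->
  (forall a, a \in G -> (key a).2 = (0 < Pi (key a).1 a)) ->
  t * group_pairs R G key
  <= \sum_a \sum_b (same_group G key a b)%:R * gram Pi a b.
Proof.
move=> t0 heavy sgn; rewrite /group_pairs mulr_sumr.
under eq_bigr do rewrite mulr_sumr; under eq_bigr do under eq_bigr do rewrite mulrC.
rewrite (sum_same_group _ _ (fun _ _ => t)) (sum_same_group _ _ (gram Pi)).
apply: ler_sum => -[r0 p] _.
pose i a : R := ((a \in G) && (key a == (r0, p)))%:R.
have sq r : \sum_a \sum_b i a * i b * (Pi r a * Pi r b) = (\sum_a i a * Pi r a) ^+ 2.
  rewrite expr2 mulr_suml; apply: eq_bigr => a _; rewrite mulr_sumr.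
  by apply: eq_bigr => b _; rewrite mulrACA.
(* The Gram sum of one group is a sum of squares over the rows, so the common row [r0] alone bounds
   it from below. *)
apply: le_trans (_ : \sum_a \sum_b i a * i b * (Pi r0 a * Pi r0 b) <= _).
  apply: ler_sum => a _; apply: ler_sum => b _; rewrite /i.
  case: (boolP (a \in G)) => [aG|_] /=; last by rewrite !mul0r.
  case: eqP => [ka|_]; last by rewrite !mul0r.
  case: (boolP (b \in G)) => [bG|_] /=; last by rewrite mulr0 !mul0r.
  case: eqP => [kb|_]; last by rewrite mulr0 !mul0r.
  have := heavy _ aG; have := heavy _ bG; have := sgn _ aG; have := sgn _ bG.
  rewrite ka kb /= !mul1r => ->; move: (Pi r0 a) (Pi r0 b) => x y.
  move=> sxy ty tx; have xy0 : 0 <= x * y.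
    move: sxy; case: (ltP 0 x); case: (ltP 0 y) => // y0 x0 _.
      by rewrite mulr_ge0 ?ltW.
    by rewrite mulr_le0.
  rewrite -ler_sqr ?nnegrE ?(ltW t0)// exprMn expr2.
  by apply: ler_pM => //; exact: ltW.
rewrite sq (le_trans (y := \sum_r (\sum_a i a * Pi r a) ^+ 2))//.
  by rewrite (bigD1 r0)//= lerDl sumr_ge0// => r _; exact: sqr_ge0.
rewrite le_eqVlt; apply/orP; left; apply/eqP.
under eq_bigr do rewrite -sq.
rewrite exchange_big; apply: eq_bigr => a _ /=.
rewrite exchange_big; apply: eq_bigr => b _ /=.
by rewrite -mulr_sumr.
Qed.

(** The largest [l] with [2 * eps * 2 ^+ l < g] suffices: below the top level [g] is at most twice
    that threshold, and at the top [16 * eps * 2 ^+ L = 2]. If there is none, [g <= 2 * eps]. *)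
Lemma dyadic_bound (R : realType) (eps g : R) L : 0 < eps ->
  2 ^+ L * (8 * eps) = 1 -> g <= 2 ->
  g <= 2 * eps + 16 * eps * \sum_(l < L.+1) 2 ^+ l * (2 * eps * 2 ^+ l < g)%R%:R.
Proof.
move=> e0 eL g2.
have term0 l : 0 <= 2 ^+ l * (2 * eps * 2 ^+ l < g)%R%:R :> R.
  by rewrite mulr_ge0 ?exprn_ge0.
have [gt|le] := ltP (2 * eps * 2 ^+ L) g.
  rewrite big_ord_recr /= gt mulr1.
  have : 0 <= \sum_(l < L) 2 ^+ l * (2 * eps * 2 ^+ l < g)%R%:R :> R.
    by apply: sumr_ge0.
  move: (\sum_(_ < _) _) => s s0; have : 0 <= eps * s by rewrite mulr_ge0 ?(ltW e0).
  by move: eL; rewrite mulrC => eL; lra.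
rewrite big_ord_recr /= [(_ < g)]ltNge le mulr0 addr0.
elim: L le {eL} => [|L IH]; first by rewrite expr0 big_ord0; lra.
rewrite exprS big_ord_recr /= mulrDr addrA => le.
have [/IH le'|gt] := leP g (2 * eps * 2 ^+ L).
  by apply: le_trans le' _; rewrite mulr0 mulr0 addr0.
have : 0 <= 16 * eps * \sum_(l < L) 2 ^+ l * (2 * eps * 2 ^+ l < g)%R%:R.
  by rewrite mulr_ge0 ?sumr_ge0// mulr_ge0 ?(ltW e0).
have : 0 <= eps * 2 ^+ L by rewrite mulr_ge0 ?exprn_ge0 ?(ltW e0).
by rewrite mulr1; lra.
Qed.

(** At most [1 / 4] of the [h] collide and at most [1 / 2] miss [E]. The remaining quarter fails for
    a quarter of the signs, which gives [1 / 16]. *)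
Lemma level_fail (R : realType) m n d k (Pi : 'M[R]_(m, n)) (eps : R)
    (E : rel 'I_n) (D : nat) :
  0 < eps < 1 -> (0 < k)%N -> (0 < n)%N -> symmetric E ->
  (forall a, (\sum_b E a b <= D)%N) ->
  (forall a b, E a b -> 2 * eps * k%:R < gram Pi a b) ->
  (4 * (d * k) ^ 2 <= n)%N ->
  (2 : R) * ((d * k)%:R * D%:R * n%:R + n%:R ^+ 2)
    <= ((d./2 * k) * ((d - d./2) * k))%:R * \sum_a \sum_b (E a b)%:R ->
  D_beta k [set U : 'M[R]_(n, d) | embeds eps Pi U]%classic <= 15 / 16.
Proof.
move=> he k0 n0 symE degE Ebig nbig ebig.
apply: le_trans (D_beta_fail d k0 he Ebig) _.
(* Splitting the positions between whole blocks puts every pair from [A] and [B] into different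
   blocks. *)
pose A := [set j : 'I_(d * k) | (j < d./2 * k)%N]; pose B := ~: A.
have dhalf : (d./2 <= d)%N by rewrite -{2}(odd_double_half d) -addnn addnA leq_addl.
have cA : #|A| = (d./2 * k)%N.
  rewrite -sum1_card; under eq_bigl do rewrite inE.
  rewrite -(big_ord_widen _ (fun=> 1%N)) ?leq_mul2r ?dhalf ?orbT//.
  by rewrite sum1_card card_ord.
have cB : #|B| = ((d - d./2) * k)%N.
  by apply: (@addnI #|A|); rewrite cardsC card_ord cA -mulnDl subnKC.
have AB : [disjoint A & B] by rewrite -finset.setI_eq0 finset.setICr.
have := second_moment R AB symE degE; have := card_not_injective R 'I_(d * k) 'I_n.
rewrite cA cB -mulnDl subnKC// !card_ord; rewrite -/A -/B.
set H := #|{ffun _}|; set e := \sum_a _.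
set X := [set h | ~~ [exists i in A, _]]; set Y := [set h : {ffun _} | ~~ injectiveb h].
set Z := [set h | _ & _] => iY iX.
have cover : (H <= #|Z| + (#|X| + #|Y|))%N.
  rewrite -[H]cardsT.
  apply: leq_trans (leq_trans (leq_card_setU Z (X :|: Y)) _); last first.
    by rewrite leq_add2l leq_card_setU.
  apply: subset_leq_card; apply/fintype.subsetP => h _; rewrite !inE.
  case: injectiveP => [_|_]; rewrite /= ?orbT// orbF.
  case: (boolP [exists i in A, _]); rewrite ?orbT// orbF.
  move=> /exists_inP[i iA /exists_inP[j jB Eij]].
  apply/existsP; exists i; apply/existsP; exists j; rewrite Eij andbT.
  move: iA jB; rewrite !inE -ltn_divLR// -ltn_divLR// => iA; apply: contraNneq.
  by move=> /(congr1 val) /= <-.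
have n0R : 0 < n%:R :> R by rewrite ltr0n.
have H0 : 0 < H%:R :> R.
  by rewrite ltr0n; apply/card_gt0P; exists [ffun=> Ordinal n0].
have YH : #|Y|%:R <= H%:R / 4 :> R.
  rewrite -(ler_pM2l n0R); apply: le_trans iY _; rewrite [n%:R * _]mulrCA ler_pM2l//.
  by move: nbig; rewrite -(ler_nat R) !natrM; lra.
have XH : #|X|%:R <= H%:R / 2 :> R.
  move: ebig iX; rewrite -/e; set W := (_ * _ + _); set w := _%:R * e => ebig.
  have W0 : 0 < W by rewrite ltr_wpDl ?exprn_gt0 ?mulr_ge0.
  have w0 : 0 < w by lra.
  rewrite -mulrA -/w -/W => iX. rewrite -(ler_pM2r w0); apply: le_trans iX _.
  by rewrite -mulrA ler_pM2l//; lra.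
move: cover; rewrite -(ler_nat R) !natrD => cover.
rewrite lerBlDl -lerBlDr ler_pdivlMr ?mulr_gt0//; lra.
Qed.

(** * Levels *)

(** Each of the two summands [d k D n] and [n ^+ 2] is shown to be at most [ab * e / 4]; this is
    where [576 = 4 * 144] comes from. *)
Lemma level_numeric (R : realFieldType) (n d k e D Q m eta l ab : R) :
  0 < d -> 1 <= k -> 0 <= e -> 0 <= D -> 0 <= n -> 0 < Q -> 0 <= m ->
  0 < eta <= 1 -> 1 <= l ->
  (d * k) ^+ 2 <= 9 * ab -> 5 * Q * eta <= 16 * (e * k) * l ->
  D ^+ 2 <= Q -> n ^+ 2 <= 8 * m * Q ->
  m * l ^+ 2 <= 4 * (1 / 100) ^+ 3 * eta ^+ 2 * d ^+ 2 ->
  2 * (d * k * D * n + n ^+ 2) <= ab * e.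
Proof.
move=> d0 k1 e0 D0 n0 Q0 m0 /andP[eta0 eta1] l1 hab he hD hn hm.
have k0 : 0 < k by lra.
have l0 : 0 < l by lra.
have d2k : 0 <= d ^+ 2 * k by rewrite mulr_ge0 ?exprn_ge0 ?ltW.
have low : 5 * d ^+ 2 * k * Q * eta <= 144 * (ab * e) * l.
  have h1 : (d ^+ 2 * k) * (5 * Q * eta) <= (d ^+ 2 * k) * (16 * (e * k) * l).
    exact: ler_wpM2l.
  have h2 : (d * k) ^+ 2 * (e * l) <= 9 * ab * (e * l).
    by apply: ler_wpM2r => //; rewrite mulr_ge0// ltW.
  by rewrite exprMn in h2; lra.
have ml : n ^+ 2 * l ^+ 2 <= 32 * (1 / 100) ^+ 3 * (eta * d) ^+ 2 * Q.
  have h1 : n ^+ 2 * l ^+ 2 <= 8 * m * Q * l ^+ 2.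
    by apply: ler_wpM2r => //; rewrite exprn_ge0// ltW.
  have h2 : 8 * Q * (m * l ^+ 2) <= 8 * Q * (4 * (1 / 100) ^+ 3 * eta ^+ 2 * d ^+ 2).
    by apply: ler_wpM2l => //; lra.
  by rewrite exprMn; lra.
have first : 576 * n ^+ 2 * l <= 5 * d ^+ 2 * k * Q * eta.
  have h1 : n ^+ 2 * l <= n ^+ 2 * l ^+ 2.
    by apply: ler_wpM2l; rewrite ?exprn_ge0// expr2 ler_peMl// ltW.
  have h2 : (eta * d) ^+ 2 * Q <= d ^+ 2 * k * Q * eta.
    rewrite exprMn (_ : _ * _ = (eta * d ^+ 2 * Q) * eta); last by ring.
    rewrite (_ : _ * k * Q * eta = (eta * d ^+ 2 * Q) * k); last by ring.
    by apply: ler_wpM2l; [rewrite !mulr_ge0 ?exprn_ge0 ?ltW|lra].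
  have h3 : 0 <= (eta * d) ^+ 2 * Q by rewrite mulr_ge0 ?exprn_ge0 ?ltW// mulr_gt0.
  by lra.
(* [D] and [n] are controlled only through their squares, so the squares are compared. The constant
   is chosen for [576 ^+ 2 * 32 / 100 ^+ 3 < 25]. *)
have second : 576 * (D * n * l) <= 5 * (d * Q * eta).
  have dQe : 0 <= d * Q * eta by rewrite !mulr_ge0 ?ltW.
  have Dnl : 0 <= D * n * l by rewrite !mulr_ge0// ltW.
  suff : (576 * (D * n * l)) ^+ 2 <= (5 * (d * Q * eta)) ^+ 2.
    by rewrite ler_sqr ?nnegrE//; apply: mulr_ge0.
  rewrite 2!exprMn.
  have h1 : D ^+ 2 * (n ^+ 2 * l ^+ 2) <=
      Q * (32 * (1 / 100) ^+ 3 * (eta * d) ^+ 2 * Q).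
    by apply: ler_pM => //; rewrite ?mulr_ge0 ?exprn_ge0// ltW.
  have h3 : 0 <= (d * Q * eta) ^+ 2 by exact: sqr_ge0.
  rewrite !exprMn in h1 h3 *; lra.
have second' : 576 * (d * k * D * n * l) <= 5 * d ^+ 2 * k * Q * eta.
  have : (d * k) * (576 * (D * n * l)) <= (d * k) * (5 * (d * Q * eta)).
    by apply: ler_wpM2l => //; rewrite mulr_ge0// ltW.
  by lra.
by rewrite -(ler_pM2r l0); lra.
Qed.

Lemma ln2_ge_half (R : realType) : 1 / 2 <= ln 2 :> R.
Proof.
have := @le_ln1Dx R (- (1 / 2)); rewrite (_ : 1 + _ = 2^-1 :> R); last by lra.
rewrite lnV ?posrE//; lra.
Qed.

(** The offset 3 in [L] turns into the factor 8. *)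
Lemma log2_dyadic (R : realType) (eps : R) L : 0 < eps ->
  L%:R = log2 (1 / eps) - 3 -> 2 ^+ L * (8 * eps) = 1.
Proof.
move=> e0 hL; have l2 := ln2_ge_half R.
have : ln (2 ^+ (L + 3)) = ln (1 / eps).
  rewrite lnXn// -[ln 2 *+ _]mulr_natr natrD hL /log2.
  by rewrite addrNK mulrC divfK// gt_eqF//; lra.
move=> /ln_inj; rewrite !posrE exprn_gt0// divr_gt0// => /(_ isT isT).
rewrite exprD (_ : 2 ^+ 3 = 8 :> R); last by ring.
by move=> h; rewrite mulrA h mul1r mulVf ?gt_eqF.
Qed.

(** Take the last [l' <= l] with [q l' < t], which exists because level 0 qualifies; every level
    skipped after it adds at least [t] to the sum. *)
Lemma last_good_level (R : realType) (q : nat -> R) (t : R) l :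
  (forall i, 0 <= q i) -> q 0%N < t ->
  exists l', [/\ (l' <= l)%N, q l' < t
    & t * (l - l')%:R <= \sum_(1 <= i < l.+1) q i].
Proof.
move=> q0 q0t; elim: l => [|l [l' [le_l' ql' IH]]].
  by exists 0%N; split => //; rewrite subnn mulr0 big_geq.
have [ql|ql] := ltP (q l.+1) t.
  by exists l.+1; split => //; rewrite subnn mulr0 sumr_ge0.
exists l'; split => //; first exact: leqW.
by rewrite subSn// -natr1 mulrDr mulr1 big_nat_recr//= lerD.
Qed.

Lemma unif_pr_le1 (R : realType) (T : finType) (A : set T) :
  unif_pr A <= 1 :> R.
Proof.
rewrite /unif_pr; have [->|T0] := posnP #|T|; first by rewrite invr0 mulr0.
by rewrite ler_pdivrMr ?ltr0n// mul1r ler_nat max_card.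
Qed.

Lemma group_size_max (R : realType) (C K : finType) (G : {set C}) (key : C -> K) :
  (\max_x group_size G key x)%:R ^+ 2 <= group_pairs R G key.
Proof.
have [K0|K0] := posnP #|K|; last first.
  by have [x ->] := bigop.eq_bigmax (group_size G key) K0; exact: group_size_le.
rewrite big_pred0 => [|x]; last by have := card0_eq K0 x.
by rewrite expr0n; apply: sumr_ge0 => a _; apply: sumr_ge0.
Qed.

Definition close_pairs (R : realType) m n (Pi : 'M[R]_(m, n)) (K : finType)
    (G : {set 'I_n}) (key : 'I_n -> K) (t : R) : rel 'I_n :=
  fun a b => same_group G key a b && (t < gram Pi a b).

(** Summing [dyadic_bound] over the pairs in a common group gives a total weight of at least [3 / 8]
    of [group_pairs], which is then spread over [L + 1] levels. *)
Lemma dense_level (R : realType) m n (Pi : 'M[R]_(m, n)) (eps : R) L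
    (G : {set 'I_n}) (key : 'I_n -> 'I_m * bool) :
  0 < eps -> 2 ^+ L * (8 * eps) = 1 ->
  (forall a b, a \in G -> b \in G -> gram Pi a b <= 2) ->
  8 * eps * group_pairs R G key
    <= \sum_a \sum_b (same_group G key a b)%:R * gram Pi a b ->
  exists l : nat, (l <= L)%N /\
    5 * group_pairs R G key <= 16 * ((\sum_a \sum_b
      (close_pairs Pi G key (2 * eps * 2 ^+ l) a b)%:R) * 2 ^+ l) * L.+1%:R.
Proof.
move=> e0 eL g2; set Q := group_pairs R G key => energy.
pose e l : R := \sum_a \sum_b (close_pairs Pi G key (2 * eps * 2 ^+ l) a b)%:R.
have Q0 : 0 <= Q by apply: sumr_ge0 => a _; apply: sumr_ge0.
have weighted : 3 * Q <= 8 * \sum_(l < L.+1) 2 ^+ l * e l.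
  suff : 8 * eps * Q <= 2 * eps * Q + 16 * eps * \sum_(l < L.+1) 2 ^+ l * e l.
    by move=> H; rewrite -(ler_pM2l e0); lra.
  apply: le_trans energy _.
  have -> : \sum_(l < L.+1) 2 ^+ l * e l = \sum_a \sum_b \sum_(l < L.+1)
      2 ^+ l * (close_pairs Pi G key (2 * eps * 2 ^+ l) a b)%:R.
    under [RHS]eq_bigr do rewrite exchange_big.
    rewrite [RHS]exchange_big; apply: eq_bigr => l _ /=.
    by rewrite mulr_sumr; apply: eq_bigr => a _; rewrite mulr_sumr.
  rewrite /Q /group_pairs !mulr_sumr -big_split; apply: ler_sum => a _ /=.
  rewrite !mulr_sumr -big_split; apply: ler_sum => b _ /=.
  rewrite /close_pairs; case: (boolP (same_group G key a b)) => /= [|_].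
    move=> /and3P[aG bG _]; rewrite mul1r mulr1.
    exact: dyadic_bound (g2 _ _ aG bG).
  rewrite mul0r mulr0 add0r; apply: mulr_ge0; first by lra.
  by apply: sumr_ge0 => l _; rewrite mulr_ge0 ?exprn_ge0.
(* Pigeonhole: if every level fell short, the total would be at most [5 / 16] of [Q], less than
   [3 / 8]; for [Q = 0] level 0 works trivially. *)
apply: contrapT => none.
have small (l : 'I_L.+1) : 2 ^+ l * e l <= 5 * Q / (16 * L.+1%:R).
  rewrite leNgt; apply/negP => big; apply: none; exists l.
  split; first by rewrite -ltnS.
  move/ltW: big; rewrite ler_pdivrMr ?mulr_gt0// -/(e l).
  by move: (L.+1%:R : R) => x; lra.
have : \sum_(l < L.+1) 2 ^+ l * e l <= 5 * Q / 16.
  apply: le_trans (ler_sum _ (fun l _ => small l)) _.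
  rewrite sumr_cardT card_ord invfM mulrCA [L.+1%:R * _]mulrCA divff ?mulr1//.
  by rewrite pnatr_eq0.
have [Q00|QN0] := eqVneq Q 0.
  move=> _; apply: none; exists 0%N; split => //; rewrite Q00 mulr0 !mulr_ge0//.
  by apply: sumr_ge0 => a _; apply: sumr_ge0.
have : 0 < Q by rewrite lt_def QN0.
by lra.
Qed.

(* The levels where the embedding may fail outright number at most [32 delta L];
   moving from level [l] down to the last good level [l'] therefore costs a
   factor at most [2 ^ (32 delta L) <= eps ^ (- 32 delta)]. *)
Lemma good_level_loss (R : realType) (eps delta : R) (q : nat -> R) L l :
  0 < eps < 1 -> 0 < delta -> 2 ^+ L * (8 * eps) = 1 ->
  (forall i, 0 <= q i) -> q 0%N < 1 / 16 ->
  \sum_(1 <= i < L.+1) q i <= 2 * delta * L%:R -> (l <= L)%N ->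
  exists l', [/\ (l' <= l)%N, q l' < 1 / 16
    & 2 ^+ (l - l') * eps `^ (32 * delta) <= 1].
Proof.
move=> /andP[e0 e1] d0 eL q0 q00 qL lL.
have [l' [le_l' ql' H]] := last_good_level l q0 q00.
exists l'; split => //.
(* Each skipped level costs at least [1 / 16] of a failure budget of [2 * delta * L]. *)
have gap : (l - l')%:R <= 32 * delta * L%:R.
  have : \sum_(1 <= i < l.+1) q i <= \sum_(1 <= i < L.+1) q i.
    by rewrite [X in _ <= X](@big_cat_nat _ _ _ l.+1)//= lerDl sumr_ge0.
  by lra.
have ln2 := ln2_ge_half R.
have lnL : L%:R * ln 2 <= - ln eps.
  have p0 : 0 < 2 ^+ L :> R by rewrite exprn_gt0.
  have : 2 ^+ L * eps <= 1 by move: (mulr_gt0 p0 e0); lra.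
  move=> /ln_le0; rewrite lnM ?posrE// lnXn// -[ln 2 *+ _]mulr_natr; lra.
rewrite leNgt; apply/negP => /ln_gt0.
rewrite lnM ?posrE ?exprn_gt0 ?powR_gt0// lnXn// ln_powR -[ln 2 *+ _]mulr_natl.
have h1 : (l - l')%:R * ln 2 <= 32 * delta * L%:R * ln 2 :> R.
  by apply: ler_wpM2r => //; lra.
have h2 : 32 * delta * (L%:R * ln 2) <= 32 * delta * - ln eps.
  by apply: ler_wpM2l => //; lra.
by lra.
Qed.

(** Both halves of the mixture have weight [1 / 2] and success at most 1, so each fails with
    probability at most [2 * delta]. *)
Lemma D_tilde_levels (R : realType) n d L (E : set 'M[R]_(n, d)) (delta : R) :
  (0 < L)%N -> 1 - delta <= D_tilde L E ->
  1 - D_beta 1 E <= 2 * delta /\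
  \sum_(1 <= l < L.+1) (1 - D_beta (2 ^ l) E) <= 2 * delta * L%:R.
Proof.
move=> L0; rewrite /D_tilde.
have sum1 : \sum_(1 <= l < L.+1) 1 = L%:R :> R.
  by rewrite sumr_const_nat subSS subn0.
have Lp : 0 < L%:R :> R by rewrite ltr0n.
have D1 : D_beta 1 E <= 1 by exact: unif_pr_le1.
have DL : \sum_(1 <= l < L.+1) D_beta (2 ^ l) E <= L%:R.
  by rewrite -sum1; apply: ler_sum => l _; exact: unif_pr_le1.
rewrite sumrB sum1.
move: DL; move: (\sum_(1 <= l < L.+1) _) => S; move: (D_beta 1 E) D1 => p p1 SL.
have SL1 : L%:R^-1 * S <= 1 by rewrite mulrC ler_pdivrMr// mul1r.
move=> H; split; first by lra.
have : L%:R * (1 - 2 * delta) <= L%:R * (L%:R^-1 * S) by rewrite ler_pM2l//; lra.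
by rewrite mulrA divff ?gt_eqF//; lra.
Qed.

Lemma level_count (R : realType) (d k : nat) : (1 < d)%N ->
  (d%:R * k%:R) ^+ 2 <= 9 * ((d./2 * k) * ((d - d./2) * k))%:R :> R.
Proof.
move=> d1; rewrite -!natrM -natrX ler_nat.
have : (d * d <= 9 * (d./2 * (d - d./2)))%N by nia.
move=> H; rewrite (_ : (9 * _ = 9 * (d./2 * (d - d./2)) * (k * k))%N); last by ring.
by rewrite expnMn -!mulnn leq_mul2r H orbT.
Qed.

(** * Assembling the estimates into the lower bound *)

Theorem theorem16 (R : realType) :
  exists eps0 delta0 c0 K0 K1 : R,
    [/\ 0 < eps0, 0 < delta0, 0 < c0, 0 < K0 & 0 < K1] /\
    forall (eps delta : R) (L d n m : nat) (Pi : 'M[R]_(m, n)),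
      0 < eps < eps0 ->
      0 < delta < delta0 ->
      L%:R = log2 (1 / eps) - 3 ->
      1 / eps ^+ 2 <= d%:R ->
      K0 * d%:R ^+ 2 / (eps ^+ 2 * delta) <= n%:R ->
      (col_sparsity Pi)%:R <= 1 / (9 * eps) ->
      subspace_embedding eps delta Pi (@D_tilde R n d L) ->
      c0 * ln (1 / eps) ^- 4 * eps `^ (K1 * delta) * d%:R ^+ 2 < m%:R.
Proof.
(* [1 / 32] serves the heavy entries, [1 / 64] makes level 0 good, [(1 / 100) ^+ 3] comes from
   [level_numeric], 16 covers the collision bound, and [64 = 2 * 32] because [eps ^ (32 delta)]
   enters squared. *)
exists (1 / 32), (1 / 64), ((1 / 100) ^+ 3), 16, 64.
split; first by split; rewrite ?exprn_gt0//; lra.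
move=> eps delta L d n m Pi /andP[e0 e1] /andP[dl0 dl1] hL hd hn hs hemb.
rewrite ltNge; apply/negP => hm.
have he : 0 < eps < 1 by lra.
have he32 : 0 < eps <= 1 / 32 by lra.
have eL := log2_dyadic e0 hL.
have ln2 := ln2_ge_half R.
set lam := ln (1 / eps) in hm hL.
have hlam : L%:R = lam / ln 2 - 3 by [].
have lamE : (L%:R + 3) * ln 2 = lam.
  by rewrite hlam addrNK divfK// gt_eqF//; lra.
have L0 : (0 < L)%N.
  by case: L eL {hL hemb hlam lamE} => // eL; lra.
have lam_ge : L.+1%:R <= 2 * lam.
  have : (L%:R + 3) * (1 / 2) <= (L%:R + 3) * ln 2 :> R by rewrite ler_wpM2l ?addr_ge0.
  by rewrite -natr1; lra.
have l_ge1 : 1 <= L.+1%:R :> R by rewrite ler1n.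
have lam1 : 1 <= lam.
  have : 1 <= L%:R :> R by rewrite ler1n.
  by move: lam_ge; rewrite -natr1; lra.
have lamP : 0 < lam by lra.
have e2 : 0 < eps ^+ 2 by rewrite exprn_gt0.
have dR : 1 < d%:R :> R.
  apply: lt_le_trans hd; rewrite ltr_pdivlMr// mul1r expr2.
  by rewrite -[X in _ < X]mulr1 ltr_pM ?ltW//; lra.
have d0 : 0 < d%:R :> R by lra.
have d1 : (1 < d)%N by rewrite -(ltr_nat R).
have hn' : 16 * d%:R ^+ 2 <= n%:R * (eps ^+ 2 * delta).
  by rewrite -ler_pdivrMr// mulr_gt0.
have n0 : (0 < n)%N.
  rewrite lt0n; apply/eqP => n00; move: hn'; rewrite n00 mul0r.
  by rewrite leNgt mulr_gt0// exprn_gt0.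
have nR : 0 < n%:R :> R by rewrite ltr0n.
pose emb := [set U : 'M[R]_(n, d) | embeds eps Pi U]%classic.
have [fail0 failL] := D_tilde_levels (E := emb) L0 hemb.
pose q l : R := 1 - D_beta (2 ^ l) emb.
have q0 l : 0 <= q l by rewrite subr_ge0; exact: unif_pr_le1.
have q00 : q 0%N < 1 / 16 by rewrite /q expn0; lra.
pose G := [set a | good_column Pi eps a].
have G_half : n%:R <= 2 * #|G|%:R :> R.
  have := good_columns Pi he (ltnW d1) n0; rewrite -/emb -/G => H.
  have : n%:R * (1 / 2) <= n%:R * D_beta 1 emb by rewrite ler_pM2l//; lra.
  by lra.
have G0 : (0 < #|G|)%N by rewrite -(ltr_nat R); lra.
have heavy a : a \in G -> exists r, 8 * eps <= Pi r a ^+ 2.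
  by rewrite inE; exact: heavy_entry.
have [r0 _] : exists r : 'I_m, True.
  by have /card_gt0P[a /heavy[r _]] := G0; exists r.
have m0 : 0 < m%:R :> R by rewrite ltr0n; case: (m) r0 => // -[].
(* The default [r0] only makes [top] total; on [G] the pick succeeds. *)
pose top a := odflt r0 [pick r | 8 * eps <= Pi r a ^+ 2].
pose key a := (top a, 0 < Pi (top a) a).
have topP a : a \in G -> 8 * eps <= Pi (key a).1 a ^+ 2.
  move=> /heavy[r hr]; rewrite /key /top /=.
  by case: pickP => [//|/(_ r)]; rewrite hr.
have energy := gram_energy (mulr_gt0 (ltr0n R 8) e0) topP (fun a _ => erefl).
have G2 a b : a \in G -> b \in G -> gram Pi a b <= 2.
  by rewrite !inE; exact: gram_le2.
have [l [lL dense]] := dense_level e0 eL G2 energy.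
move: dense; set Q := group_pairs R G key => dense.
(* At least [n / 2] good columns fall into at most [2 m] groups, one for each row and sign. *)
have nQ : n%:R ^+ 2 <= 8 * m%:R * Q.
  have := group_pairs_ge R G key; rewrite -/Q card_prod card_ord card_bool natrM.
  have : n%:R ^+ 2 <= (2 * #|G|%:R) ^+ 2 :> R.
    by rewrite ler_sqr ?nnegrE ?mulr_ge0.
  by rewrite exprMn; lra.
have Q0 : 0 < Q.
  have : 0 < 8 * m%:R * Q by apply: lt_le_trans nQ; rewrite exprn_gt0.
  by rewrite pmulr_rgt0// mulr_gt0.
have [l' [le_l' ql' loss]] := good_level_loss he dl0 eL q0 q00 failL lL.
move: loss; set eta := eps `^ (32 * delta) => loss.
have eta0 : 0 < eta by rewrite powR_gt0.
have eta1 : eta <= 1.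
  apply: le_trans loss; rewrite ler_peMl ?(ltW eta0)//.
  by rewrite exprn_ege1// ler1n.
set D := (\max_x group_size G key x)%N.
pose E := close_pairs Pi G key (2 * eps * 2 ^+ l').
pose e : R := \sum_a \sum_b (E a b)%:R.
have e_ge0 : 0 <= e by apply: sumr_ge0 => a _; apply: sumr_ge0.
(* Lowering the threshold from [l] to [l'] only adds pairs, and [eta] absorbs the lost factor
   [2 ^+ (l - l')]. *)
have he' : 5 * Q * eta <= 16 * (e * 2 ^+ l') * L.+1%:R.
  have mono : \sum_a \sum_b (close_pairs Pi G key (2 * eps * 2 ^+ l) a b)%:R <= e.
    apply: ler_sum => a _; apply: ler_sum => b _; rewrite ler_nat /E /close_pairs.
    case: (same_group _ _ _ _) => //=.
    case: (ltP _ (gram Pi a b)) => // lt_l; case: ltP => //.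
    rewrite leNgt => /negP[]; apply: le_lt_trans lt_l.
    by rewrite ler_pM2l ?mulr_gt0// ler_weXn2l// ler1n.
  have h1 : 5 * Q * eta <= 16 * (e * 2 ^+ l) * L.+1%:R * eta.
    rewrite ler_pM2r//; apply: le_trans dense _.
    by rewrite ler_pM2r ?ltr0n// ler_pM2l// ler_pM2r ?exprn_gt0.
  apply: le_trans h1 _; rewrite -{1}(subnK le_l') exprD.
  have := ler_wpM2l (mulr_ge0 (mulr_ge0 (ler0n R 16) (mulr_ge0 e_ge0
    (exprn_ge0 l' (ler0n R 2)))) (ler0n R L.+1)) loss.
  by rewrite mulr1; lra.
have kk : (1 : R) <= (2 ^ l')%:R by rewrite ler1n expn_gt0.
(* The assumed upper bound on [m] enters here, with [L + 1 <= 2 * lam] and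
   [lam ^+ 2 * lam ^- 4 <= 1] since [lam >= 1]. *)
have hml : m%:R * L.+1%:R ^+ 2 <= 4 * (1 / 100) ^+ 3 * eta ^+ 2 * d%:R ^+ 2.
  have etaE : eps `^ (64 * delta) = eta ^+ 2.
    by rewrite -powR_mulrn ?(ltW eta0)// -powRrM; congr (_ `^ _); ring.
  rewrite etaE in hm.
  have h1 : L.+1%:R ^+ 2 <= 4 * lam ^+ 2.
    have : L.+1%:R ^+ 2 <= (2 * lam) ^+ 2.
      by rewrite ler_sqr ?nnegrE ?mulr_ge0 ?(ltW lamP).
    by rewrite exprMn; lra.
  have h2 : lam ^+ 2 * lam ^- 4 <= 1.
    rewrite ler_pdivrMr ?exprn_gt0// mul1r.
    by apply: ler_weXn2l.
  have X0 : 0 <= (1 / 100) ^+ 3 * eta ^+ 2 * d%:R ^+ 2 :> R.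
    rewrite mulr_ge0 ?sqr_ge0// mulr_ge0 ?sqr_ge0// exprn_ge0//.
    by rewrite divr_ge0.
  have h3 : m%:R * L.+1%:R ^+ 2 <= m%:R * (4 * lam ^+ 2) by rewrite ler_pM2l.
  have h4 : m%:R * (4 * lam ^+ 2) <=
      (1 / 100) ^+ 3 * lam ^- 4 * eta ^+ 2 * d%:R ^+ 2 * (4 * lam ^+ 2).
    by rewrite ler_pM2r// mulr_gt0// exprn_gt0.
  have h5 := ler_wpM2l X0 h2.
  by move: h3 h4 h5; move: (lam ^- 4) => u; rewrite mulr1; lra.
have eta01 : 0 < eta <= 1 by rewrite eta0.
rewrite -natrX in he'.
have := level_numeric d0 kk e_ge0 (ler0n R D) (ltW nR) Q0 (ltW m0) eta01 l_ge1
  (level_count R (2 ^ l') d1) he' (group_size_max R G key) nQ hml.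
rewrite -natrM => final.
(* A failure probability of [1 / 16] at [l'] contradicts the choice of [l'] as a good level. *)
suff : D_beta (2 ^ l') emb <= 15 / 16 by move: ql'; rewrite /q; lra.
apply: (level_fail he _ n0 _ _ _ _ final).
- by rewrite expn_gt0.
- move=> a b; rewrite /E /close_pairs gramC /same_group eq_sym.
  by case: (a \in G); case: (b \in G).
- move=> a; apply: leq_trans (same_group_degree G key a).
  apply: leq_sum => b _; rewrite /E /close_pairs.
  by case: (same_group _ _ _ _); case: (_ < _).
- by move=> a b /andP[_]; rewrite natrX.
(* For the collision bound: [2 ^ l' <= 2 ^ L = 1 / (8 * eps)], so [(d * 2 ^ l') ^ 2] is at most of
   order [d ^ 2 / eps ^ 2], which the size of [n] dominates. *)
have Ke : (2 ^ l')%:R * eps <= 1.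
  have : (2 ^ l')%:R * eps <= 2 ^+ L * eps.
    by rewrite ler_pM2r// natrX ler_weXn2l ?ler1n// (leq_trans le_l').
  by lra.
rewrite -(ler_nat R) !natrM -(ler_pM2r (mulr_gt0 e2 dl0)); apply: le_trans hn'.
have K2 : (2 ^ l')%:R * eps * ((2 ^ l')%:R * eps) * delta <= 1.
  have K0 : 0 <= (2 ^ l')%:R * eps by rewrite mulr_ge0 ?(ltW e0).
  have delta_le1 : delta <= 1 by lra.
  exact: mulr_ile1 (mulr_ge0 K0 K0) (ltW dl0) (mulr_ile1 K0 K0 Ke Ke) delta_le1.
have := ler_wpM2l (exprn_ge0 2 (ltW d0)) K2; have := exprn_ge0 2 (ltW d0).
by move: (d%:R : R) ((2 ^ l')%:R : R) => x y; clear; rewrite mulr1; lra.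
Qed.
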